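(* Let $p$ be a prime. Then $\mathscr{A}(p)\supset\mathscr{B}(p)$. Moreover, for $(r,e,d)\in\mathscr{B}(p)$ the exponent is $g=2e-(p-1)$, i.e. $\det M_d(f(x)^e)=\varepsilon_{p,r,e,d}\,\delta(x_1,\ldots,x_r)^{2e-(p-1)}$, and the constant $\varepsilon_{p,r,e,d}\in\mathbb{F}_p^{\times}$ is given by \[ \varepsilon_{p,r,e,d}=\begin{cases}(-1)^{r-1}\,\varepsilon_{p,r,e,d-1} & \text{if } (r,e,d)\in\mathscr{B}_+(p),\\[2pt] (-1)^{\frac{(r+1)(r+2)}{2}+\frac{r(r+1)}{2}e}\,\{r(p-1-e)\}!\,(e!)^r & \text{if } (r,e,d)\in\mathscr{B}_0(p),\\[2pt] (-1)^{r}\,\varepsilon_{p,r,e,d+1} & \text{if } (r,e,d)\in\mathscr{B}_-(p).\end{cases} \] (Here, if $(r,e,d)\in\mathscr{B}_+(p)$ then $(r,e,d-1)\in\mathscr{B}_0(p)$, and if $(r,e,d)\in\mathscr{B}_-(p)$ then $(r,e,d+1)\in\mathscr{B}_0(p)$.)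
   Context: Let $p$ be a prime. For an integer $r\ge 2$ let $x_1,\ldots,x_r$ be independent indeterminates over $\mathbb{F}_p$ and $f(x)=(x-x_1)\cdots(x-x_r)=x^r+s_1x^{r-1}+\cdots+s_r\in\mathbb{F}_p[x_1,\ldots,x_r][x]$. For integers $e\ge 0$ and $0\le d\le p$ write $f(x)^e=\sum_{i\ge0}c_ix^i$ (with $c_i=0$ for $i<0$) and let $M_d(f(x)^e)$ be the $d\times d$ matrix whose $(i,j)$ entry is $c_{ip+j-d-1}$ ($1\le i,j\le d$). Put $\delta(x_1,\ldots,x_r)=\prod_{1\le i<j\le r}(x_i-x_j)$. Define $\mathscr{A}(p)$ as the set of $(r,e,d)\in\mathbb{Z}^3$ with $r\ge2$, $e\ge1$, $1\le d\le p$, such that there exist $\varepsilon_{p,r,e,d}\in\mathbb{F}_p^{\times}$ and a positive integer $g$ with $\det M_d(f(x)^e)=\varepsilon_{p,r,e,d}\,\delta(x_1,\ldots,x_r)^g$. Define $\mathscr{B}_+(p)=\{(r,e,d): 2\le r\le p,\ e=p-1,\ d=r\}$, $\mathscr{B}_0(p)=\{(r,e,d): 2\le r\le p+1,\ (p-1)/2<e\le p-1,\ r(p-1-e)\le p-1,\ d=r-1\}$, $\mathscr{B}_-(p)=\{(r,e,d): r\ge2,\ (p-1)/2<e\le p-1,\ r(p-1-e)=p-1,\ d=r-2\}$ (all integer triples), and $\mathscr{B}(p)=\mathscr{B}_+(p)\cup\mathscr{B}_0(p)\cup\mathscr{B}_-(p)$. *)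

(* Defs.v *)
From HB Require Import structures.
From mathcomp Require Import all_boot all_order all_algebra.
From mathcomp Require Import mpoly.
Set Implicit Arguments. Unset Strict Implicit. Unset Printing Implicit Defensive.
Import Order.TTheory GRing.Theory.
Local Open Scope ring_scope.

Definition fpoly (p r : nat) : {poly {mpoly 'F_p[r]}} :=
  \prod_(i < r) ('X - ('X_i)%:P).

Definition coef_ext (p r e : nat) (k : int) : {mpoly 'F_p[r]} :=
  match k with
  | Posz n => (fpoly p r ^+ e)`_n
  | Negz _ => 0
  end.

(* M_d(f^e): (i,j) entry c_{ip+j-d-1}, 1 <= i,j <= d (ordinals shifted by 1) *)
Definition Mmat (p r e d : nat) : 'M[{mpoly 'F_p[r]}]_d :=
  \matrix_(i < d, j < d)
    coef_ext p r e ((i.+1 * p + j.+1)%:Z - (d.+1)%:Z).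

Definition delta (p r : nat) : {mpoly 'F_p[r]} :=
  \prod_(i < r) \prod_(j < r | (i < j)%N) ('X_i - 'X_j).

Definition inA (p r e d : nat) : Prop :=
  [/\ (2 <= r)%N, (1 <= e)%N, (1 <= d <= p)%N &
    exists2 eps : 'F_p, eps != 0 &
      exists2 g : nat, (0 < g)%N &
        \det (Mmat p r e d) = eps%:MP * delta p r ^+ g].

(* The sets B_+(p), B_0(p), B_-(p); condition (p-1)/2 < e written as p-1 < 2e *)
Definition inBplus (p r e d : nat) : Prop :=
  [/\ (2 <= r <= p)%N, e = p.-1 & d = r].
Definition inB0 (p r e d : nat) : Prop :=
  [/\ (2 <= r <= p.+1)%N, (p.-1 < 2 * e)%N, (e <= p.-1)%N,
      (r * (p.-1 - e) <= p.-1)%N & d = r.-1].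
Definition inBminus (p r e d : nat) : Prop :=
  [/\ (2 <= r)%N, (p.-1 < 2 * e)%N, (e <= p.-1)%N,
      (r * (p.-1 - e) = p.-1)%N & d = r.-2].
Definition inB (p r e d : nat) : Prop :=
  inBplus p r e d \/ inB0 p r e d \/ inBminus p r e d.

Definition eps0 (p r e : nat) : 'F_p :=
  (-1) ^+ ((r.+1 * r.+2) %/ 2 + (r * r.+1) %/ 2 * e)%N
  * ((r * (p.-1 - e))`!)%:R * (e`!)%:R ^+ r.

(* Main.v *)
Require Import Defs.
From HB Require Import structures.
From mathcomp Require Import all_boot all_order all_algebra.
From mathcomp Require Import mpoly.
From mathcomp Require Import perm zify ring.
Import Order.TTheory GRing.Theory.
Local Open Scope ring_scope.
Set Implicit Arguments. Unset Strict Implicit. Unset Printing Implicit Defensive.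

(** The matrix [M_d(f^e)] represents [g |-> C(g f^e)] on polynomials [g] of
    degree [< d], where [C] extracts the coefficients of [x^(ip-1)] (the Cartier
    operator).  In characteristic [p], [C(h)(a^p)] is the Taylor coefficient of
    order [p-1] of [h] at [a].  If [a] is a root of [f = (x-a) F], [d = r-1] and
    [m = p-1-e], it is the Taylor coefficient of order [m] of [g F^e] at [a]; as a
    function of [a] this is a multiple of [F(a)^(e-m)].  So replacing the first
    row of the matrix by the combination computing [C(g f^e)(a^p)] shows that
    [F(a)^(e-m)] divides the determinant.  Multiplying the matrix on the left by
    the Vandermonde matrix of the [p]-th powers of [a] and of all other roots but
    one bounds the degree in [a], and comparing top coefficients expresses the
    cofactor through the determinant for [F].  The case [d = r-1] follows by
    induction on [r]; in the two other cases one passes from [d] to [d-1] because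
    the last row is [(1, 0, ..., 0)]. *)

(** * Top coefficients of products and determinants *)

Lemma coefM_top (R : nzRingType) (u v : {poly R}) (a b : nat) :
  (size u <= a.+1)%N -> (size v <= b.+1)%N -> (u * v)`_(a + b) = u`_a * v`_b.
Proof.
move=> ua vb; have la : (a < (a + b).+1)%N by rewrite ltnS leq_addr.
rewrite coefM (bigD1 (Ordinal la)) //= addKn big1 ?addr0 // => i /eqP ne.
case: (ltngtP i a) => ia; last by case: ne; apply: val_inj.
- by rewrite [v`_ _]nth_default ?mulr0 //; apply: leq_trans vb _; lia.
- by rewrite [u`_ _]nth_default ?mul0r //; apply: leq_trans ua _.
Qed.

Lemma size_coef_prod_top (R : comNzRingType) (I : Type) (r : seq I) (F : I -> {poly R})
    (d : I -> nat) :
  (forall i, (size (F i) <= (d i).+1)%N) ->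
  (size (\prod_(i <- r) F i)%R <= (\sum_(i <- r) d i).+1)%N /\
  (\prod_(i <- r) F i)`_(\sum_(i <- r) d i) = \prod_(i <- r) (F i)`_(d i).
Proof.
move=> hF; elim: r => [|i r [szr cr]]; first by rewrite !big_nil size_poly1 coefC.
rewrite !big_cons coefM_top // cr; split=> //.
apply: leq_trans (size_polyMleq _ _) _; move: (hF i) szr.
by move: (size (F i)) (size _) => x y; lia.
Qed.

(** Each Leibniz term takes one entry from every row, so degree bounds on the rows add up and top
    coefficients multiply. *)
Lemma size_coef_det_top (R : comNzRingType) (n : nat) (A : 'M[{poly R}]_n) (d : 'I_n -> nat) :
  (forall i j, (size (A i j) <= (d i).+1)%N) ->
  (size (\det A) <= (\sum_i d i).+1)%N /\
  (\det A)`_(\sum_i d i) = \det (\matrix_(i, j) (A i j)`_(d i)).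
Proof.
move=> hA; have hP (s : 'S_n) := size_coef_prod_top (index_enum 'I_n)
  (F := fun i => A i (s i)) (d := d)
  (fun i => hA i (s i)).
split.
  apply: leq_trans (size_sum _ _ _) _; apply/bigmax_leqP => s _.
  by rewrite -signr_odd; case: (odd _);
    rewrite ?mulN1r ?mul1r ?size_polyN; case: (hP s).
rewrite coef_sum; apply: eq_bigr => s _.
under [in RHS]eq_bigr do rewrite mxE.
rewrite -[in LHS]signr_odd -[in RHS]signr_odd.
by case: (odd _); rewrite ?mulN1r ?mul1r ?coefN (hP s).2.
Qed.

(** * Taylor coefficients (Hasse derivatives), in particular of order [p.-1] in characteristic
    [p] *)

Lemma nderivnMX (R : nzRingType) (q : {poly R}) (n : nat) :
  (q * 'X)^`N(n.+1) = q^`N(n) + q^`N(n.+1) * 'X.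
Proof. by have := nderivnMXaddC n q 0; rewrite addr0. Qed.

Lemma nderivnM (R : comNzRingType) (u v : {poly R}) (n : nat) :
  (u * v)^`N(n) = \sum_(i < n.+1) u^`N(i) * v^`N(n - i).
Proof.
elim/poly_ind: u n => [|u c IH] n.
  by rewrite mul0r linear0 big1 // => i _; rewrite linear0 mul0r.
rewrite mulrDl mulrAC linearD /= mul_polyC linearZ /=.
case: n => [|n]; first by rewrite big_ord_recl big_ord0 addr0 !nderivn0 mulrDl mul_polyC mulrAC.
rewrite nderivnMX !IH [in RHS]big_ord_recl /= !nderivn0 subn0.
under [in RHS]eq_bigr do rewrite /bump /= subSS nderivnMXaddC mulrDl mulrAC.
rewrite [in RHS]big_split /= -mulr_suml [\sum_(i < n.+2) _]big_ord_recl /= nderivn0 subn0.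
under [\sum_(i < n.+1) u^`N(i.+1) * _]eq_bigr do rewrite -subSS.
by rewrite -mul_polyC mulrDl -/bump; ring.
Qed.

Lemma sum_factor (R : nzRingType) (I : Type) (r : seq I) (c : R) (F : I -> R) :
  (forall i, exists q, F i = c * q) -> exists Q, \sum_(i <- r) F i = c * Q.
Proof.
move=> hF; elim: r => [|i r [Q IH]]; first by exists 0; rewrite big_nil mulr0.
by have [q hq] := hF i; exists (q + Q); rewrite big_cons IH hq mulrDr.
Qed.

(** By the Leibniz rule, a Hasse derivative of order [n] destroys at most [n] factors [G]. Truncated
    subtraction makes the claim trivial for [n >= e]. *)
Lemma dvd_nderivn_exp (R : comNzRingType) (G w : {poly R}) (e n : nat) :
  exists Q, (G ^+ e * w)^`N(n) = G ^+ (e - n) * Q.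
Proof.
have lower k l x : (l <= k)%N -> exists q, G ^+ k * x = G ^+ l * q.
  by move=> lk; exists (G ^+ (k - l) * x); rewrite mulrA -exprD subnKC.
elim: e n => [|e IH] n; first by exists (w^`N(n)); rewrite sub0n !expr0 !mul1r.
rewrite exprS -mulrA nderivnM; apply: sum_factor => -[[|i] lti] /=.
  have [Q ->] := IH (n - 0)%N; rewrite nderivn0 mulrA -exprS; apply: lower; lia.
by have [Q ->] := IH (n - i.+1)%N; rewrite mulrCA; apply: lower; lia.
Qed.

(** In the Taylor expansion at [a], multiplication by the power of ['X - a%:P] shifts the
    coefficients by [e]. *)
Lemma horner_nderivn_XsubC_exp (R : comNzRingType) (a : R) (u : {poly R}) (e n : nat) :
  (('X - a%:P) ^+ e * u)^`N(e + n).[a] = u^`N(n).[a].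
Proof.
elim: e => [|e IH]; first by rewrite mul1r.
rewrite exprS -mulrA addSn mulrBl mulrC linearB /= nderivnMX mul_polyC linearZ /=.
by rewrite !hornerE IH; ring.
Qed.

(** A case of Lucas's theorem: as ['C(p, i)] vanishes for [0 < i < p], Vandermonde's convolution
    shows that only [k] modulo [p] matters. *)
Lemma bin_pchar_pred (R : nzRingType) (p : nat) (pR : p \in [pchar R]) (k : nat) :
  ('C(k, p.-1))%:R = (p %| k.+1)%:R :> R.
Proof.
have p_pr := pcharf_prime pR; have p0 := prime_gt0 p_pr.
rewrite {1}(divn_eq k p); have := ltn_pmod k p0; set r := (k %% p)%N => rp.
have -> : (p %| k.+1)%N = (r == p.-1).
  have -> : k.+1 = (k %/ p * p + r.+1)%N by rewrite addnS -divn_eq.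
  rewrite dvdn_addr ?dvdn_mull //; apply/idP/eqP => [/dvdn_leq -/(_ isT)|->]; first lia.
  by rewrite prednK.
elim: (k %/ p)%N => [|q IH].
  rewrite mul0n add0n; case: eqP => [->|ne]; first by rewrite binn.
  by rewrite bin_small //; lia.
rewrite mulSn -addnA -binomial.Vandermonde natr_sum big_ord_recl /= bin0 mul1n subn0 IH.
rewrite big1 ?addr0 // => i _; rewrite natrM /bump /= add1n.
rewrite (bin_lt_pcharf_0 pR) ?mul0r //.
by rewrite /= -[X in (_ < X)%N](prednK p0) ltnS.
Qed.

Lemma sum_dvdn (V : nmodType) (n p : nat) (F : nat -> V) : (0 < p)%N ->
  \sum_(l < n * p | (p %| l)%N) F l = \sum_(i < n) F (i * p)%N.
Proof.
case: p => // p _; elim: n => [|n IH]; first by rewrite mul0n !big_ord0.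
rewrite big_ord_recr /= -IH mulSnr !(big_mkcond (fun i => p.+1 %| _)%N) big_split_ord /=.
congr (_ + _); rewrite big_ord_recl /= addn0 dvdn_mull // big1 ?addr0 // => i _.
by rewrite dvdn_addr ?dvdn_mull // /bump gtnNdvd //= add1n ltnS.
Qed.

(** The binomials ['C(k, p.-1)] kill every exponent [k] not congruent to -1 modulo [p]. The size
    bound makes the coefficient of index [n * p + p.-1] and all later ones vanish, so [n] terms
    suffice. *)
Lemma horner_nderivn_pchar (R : comNzRingType) (p : nat) (pR : p \in [pchar R])
    (a : R) (h : {poly R}) (n : nat) : (size h < n.+1 * p)%N ->
  h^`N(p.-1).[a] = \sum_(i < n) a ^+ (p * i) * h`_(i * p + p.-1).
Proof.
have p0 := prime_gt0 (pcharf_prime pR) => hn.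
rewrite (@horner_coef_wide _ (n * p)); last first.
  apply/leq_sizeP => j hj; rewrite coef_nderivn nth_default ?mul0rn //.
  by move: hn hj; rewrite mulSn; move: (size h) (n * p)%N => x y; lia.
transitivity (\sum_(l < n * p | (p %| l)%N) a ^+ l * h`_(l + p.-1)).
  rewrite [RHS]big_mkcond /=; apply: eq_bigr => i _.
  rewrite coef_nderivn -mulr_natr bin_pchar_pred // -addSn prednK //.
  rewrite dvdn_addr // addnC [LHS]mulrC.
  by case: (_ %| _)%N; rewrite ?mulr1 // !mulr0.
rewrite (sum_dvdn _ (fun l => a ^+ l * h`_(l + p.-1)) p0).
by apply: eq_bigr => i _; rewrite mulnC.
Qed.

(** * Cartier matrices, and their determinant as a function of one root *)

Definition linprod (R : nzRingType) (s : seq R) : {poly R} :=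
  \prod_(a <- s) ('X - a%:P).

(* Column [j] carries the monomial ['X^(d - 1 - j)], matching the order of [Mmat]. *)
Definition cartier_mx (R : nzRingType) (p : nat) (h : {poly R}) (d : nat) : 'M[R]_d :=
  \matrix_(i, j) ('X^(d - j.+1) * h)`_(i * p + p.-1).

Lemma linprod_cons (R : nzRingType) (a : R) (s : seq R) :
  linprod (a :: s) = ('X - a%:P) * linprod s.
Proof. by rewrite /linprod big_cons. Qed.

Lemma monic_linprod (R : nzRingType) (s : seq R) : linprod s \is monic.
Proof. exact: monic_prod_XsubC. Qed.

Lemma map_linprod (R S : nzRingType) (f : {rmorphism R -> S}) (s : seq R) :
  map_poly f (linprod s) = linprod (map f s).
Proof.
rewrite /linprod rmorph_prod big_map; apply: eq_bigr => a _.
by rewrite rmorphB /= map_polyX map_polyC.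
Qed.

Lemma size_linprod_exp (R : idomainType) (s : seq R) (e : nat) :
  size (linprod s ^+ e) = (size s * e).+1.
Proof.
rewrite (polySpred (monic_neq0 (monic_exp e (monic_linprod s)))) size_exp.
by rewrite /linprod size_prod_XsubC.
Qed.

Lemma map_cartier_mx (R S : nzRingType) (f : {rmorphism R -> S}) (p : nat)
    (h : {poly R}) (d : nat) :
  map_mx f (cartier_mx p h d) = cartier_mx p (map_poly f h) d.
Proof. by apply/matrixP => i j; rewrite !mxE -coef_map rmorphM /= map_polyXn. Qed.

(** With [a] for the inner variable, only the term [(-a)^e] of the binomial expansion of [(x - a)^e]
    reaches degree [e] in [a]. *)
Lemma size_coef_XsubX_exp_mul (R : comNzRingType) (u : {poly R}) (e l : nat) :
  let q := (('X - ('X)%:P) ^+ e * u^:P)`_l in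
  (size q <= e.+1)%N /\ q`_e = (-1) ^+ e * u`_l.
Proof.
elim: e l => [|e IH] l /=; first by rewrite !mul1r coef_map /= coefC eqxx size_polyC leq_b1.
rewrite exprS -mulrA mulrBl coefB coefXM coefCM coefB coefXM /=.
have [sz ce] := IH l; split.
  apply: leq_trans (size_polyD _ _) _; rewrite size_polyN geq_max; apply/andP; split.
    case: l {sz ce} => [|l] /=; first by rewrite size_poly0.
    by apply: leq_trans (IH l).1 _.
  apply: leq_trans (size_polyMleq _ _) _; rewrite size_polyX; exact: sz.
rewrite ce; case: l {sz ce} => [|l] /=; first by rewrite coef0 sub0r exprS mulN1r mulNr.
by rewrite [_`_e.+1]nth_default ?(IH l).1 // sub0r exprS mulN1r mulNr.
Qed.

(** This is a Vandermonde determinant in [p]-th powers, which stay distinct because Frobenius is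
    injective on a domain. *)
Lemma det_pow_neq0 (R : idomainType) (p : nat) (pR : p \in [pchar R]) (s : seq R) :
  uniq s -> \det (\matrix_(i < size s, k < size s) s`_i ^+ (p * k)) != 0.
Proof.
move=> us; rewrite -det_tr.
have -> : (\matrix_(i < size s, k < size s) s`_i ^+ (p * k))^T =
    Vandermonde (size s) (\row_(i < size s) (s`_i ^+ p)).
  by apply/matrixP => i k; rewrite !mxE exprM.
rewrite det_Vandermonde; apply/prodf_neq0 => i _; apply/prodf_neq0 => j ij.
rewrite !mxE -!(pFrobenius_autE pR) -pFrobenius_autB_comm ?pFrobenius_autE; last exact: mulrC.
by rewrite expf_neq0 // subr_eq0 nth_uniq // gtn_eqF.
Qed.

Lemma det_row_delta (R : comNzRingType) (n : nat) (A : 'M[R]_n.+1) (i0 j0 : 'I_n.+1) (c : R) :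
  (forall j, A i0 j = c *+ (j == j0)) ->
  \det A = c * (-1) ^+ (i0 + j0) * \det (row' i0 (col' j0 A)).
Proof.
move=> hA; rewrite (expand_det_row _ i0) (bigD1 j0) //= big1 ?addr0.
  by rewrite hA eqxx mulr1n /cofactor mulrA.
by move=> j /negbTE jj; rewrite hA jj mulr0n mul0r.
Qed.

(* The coefficient indeterminate ['X] of [{poly R}] plays the role of the root [a] in the
   header, so that degrees in [a] make sense. *)
Lemma det_cartier_var (R : idomainType) (p e m : nat) (b : R) (s : seq R) :
  p \in [pchar R] -> (e + m)%N = p.-1 -> (m <= e)%N -> ((size s).+2 * m <= p.-1)%N ->
  uniq s ->
  \det (cartier_mx p (linprod ('X :: map polyC (b :: s)) ^+ e) (size s).+1) =
    linprod (b :: s) ^+ (e - m) *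
    ((-1) ^+ size s * (-1) ^+ (e * size s) * ('C(size s + (size s).+1 * e, m))%:R *
     \det (cartier_mx p (linprod (b :: s) ^+ e) (size s)))%:P.
Proof.
move=> pR em me nm us; set n := size s; set G := linprod (b :: s).
set h := linprod _ ^+ e; set A := cartier_mx p h n.+1.
have p0 := prime_gt0 (pcharf_prime pR).
have pRX : p \in [pchar {poly R}] by rewrite pchar_poly.
(* [D] is the degree of [u 0]; in general [u j] has degree [D - j]. *)
set D := (n + n.+1 * e)%N.
pose u (j : 'I_n.+1) := 'X^(n - j) * G ^+ e.
have sz_u j : size (u j) = (n - j + n.+1 * e).+1.
  rewrite /u mulrC size_mulXn; first by rewrite size_linprod_exp addnS.
  by rewrite monic_neq0 // monic_exp ?monic_linprod.
have mon_u j : u j \is monic by rewrite monicMl ?monicXn // monic_exp ?monic_linprod.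
have hE : h = ('X - ('X)%:P) ^+ e * (G ^+ e)^:P.
  by rewrite /h linprod_cons exprMn rmorphXn /= map_linprod.
have AE k j : A k j = (('X - ('X)%:P) ^+ e * (u j)^:P)`_(k * p + p.-1).
  by rewrite mxE hE subSS /u rmorphM /= map_polyXn mulrCA.
have comb y j : \sum_(k < n.+1) y ^+ (p * k) * A k j =
    (('X - ('X)%:P) ^+ e * (u j)^:P)^`N(p.-1).[y].
  rewrite (horner_nderivn_pchar pRX _ (n := n.+1)); first by apply: eq_bigr => k _; rewrite AE.
  rewrite (leq_ltn_trans (size_polyMleq _ _)) //.
  rewrite size_exp_XsubC size_map_polyC sz_u /=.
  have : (n.+2 * (e + m).+1 = n.+2 * p)%N by rewrite em prednK.
  have := leq_subr j n; rewrite -/n; move: (n - j)%N => x; nia.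
(* At the root ['X] itself the factor of multiplicity [e] lowers the order from [p.-1 = e + m] to
   [m]. *)
have comb0 j : \sum_(k < n.+1) 'X ^+ (p * k) * A k j = (u j)^`N(m).
  rewrite comb -em horner_nderivn_XsubC_exp nderivn_map.
  exact: comp_polyXr.
have [Q detQ] : exists Q, \det A = G ^+ (e - m) * Q.
  (* Left multiplication by the unimodular [U] replaces the first row of [A] by the one in [comb0],
     all of whose entries are divisible by [G ^+ (e - m)]. *)
  pose U : 'M[{poly R}]_n.+1 :=
    \matrix_(i, k) if i == 0 then 'X ^+ (p * k) else (i == k)%:R.
  have detU : \det U = 1.
    rewrite -det_tr det_trig; last first.
      by apply/is_trig_mxP => i j ij; rewrite !mxE -!val_eqE !gtn_eqF // (leq_ltn_trans _ ij).
    by rewrite big1 // => i _; rewrite !mxE eqxx; case: eqP => [->|//]; rewrite muln0.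
  rewrite -[\det A]mul1r -detU -det_mulmx (expand_det_row _ 0).
  apply: sum_factor => j; have [q hq] := dvd_nderivn_exp G 'X^(n - j) e m.
  exists (q * cofactor (U *m A) 0 j); rewrite [RHS]mulrA -hq mulrC [in RHS]mulrC.
  congr (_ * _); rewrite [X in X^`N(m)]mulrC -[_ * _]/(u j) -comb0 mxE.
  by apply: eq_bigr => k _; rewrite mxE eqxx.
(* There are [n.+2] roots for [n.+1] rows; [b] is the one left out. *)
pose W : 'M[{poly R}]_n.+1 := \matrix_(i, k) ('X :: map polyC s)`_i ^+ (p * k).
pose V : 'M[R]_n := \matrix_(i, k) s`_i ^+ (p * k).
have V0 : \det V != 0 by exact: det_pow_neq0.
have [szW topW] : (size (\det W) <= (p * n).+1)%N /\ (\det W)`_(p * n) = (-1) ^+ n * \det V.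
  pose d (i : 'I_n.+1) := if i == 0 then (p * n)%N else 0%N.
  have hd : (\sum_i d i = p * n)%N.
    by rewrite big_ord_recl big1 // addn0.
  rewrite -hd; have [|sz ->] := @size_coef_det_top _ _ W d.
    move=> i j; rewrite mxE /d; case: (unliftP 0 i) => [i'|] ->.
      by rewrite lift0 /= (nth_map 0) ?ltn_ord // -polyC_exp size_polyC leq_b1.
    by rewrite size_polyXn ltnS leq_mul2l -ltnS ltn_ord orbT.
  split=> //; rewrite (@det_row_delta _ _ _ 0 ord_max 1) ?mul1r.
    congr (_ * \det _); apply/matrixP => i k; rewrite !mxE /d lift_max lift0 /=.
    by rewrite (nth_map 0) ?ltn_ord // -polyC_exp coefC eqxx.
  by move=> j; rewrite !mxE /d /= coefXn eqn_mul2l gtn_eqF //= eq_sym.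
(* Row 0 of [W *m A] has degree at most [D - m] and the others at most [e]. In row 0 only column 0
   attains the bound, with coefficient ['C(D, m)]; the remaining minor factors through [V]. *)
have [szB topB] : (size (\det (W *m A)) <= (D - m + n * e).+1)%N /\
   (\det (W *m A))`_(D - m + n * e) =
     ('C(D, m))%:R * ((-1) ^+ (e * n) * (\det V * \det (cartier_mx p (G ^+ e) n))).
  have Dm : (m <= D)%N by rewrite /D; nia.
  have row0 j : (W *m A) 0 j = (u j)^`N(m).
    by rewrite -comb0 mxE; apply: eq_bigr => k _; rewrite mxE.
  have rowS i j : (W *m A) (lift 0 i) j = \sum_(k < n.+1) (s`_i ^+ (p * k))%:P * A k j.
    rewrite mxE; apply: eq_bigr => k _; rewrite mxE lift0 /= (nth_map 0) ?ltn_ord //.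
    by rewrite -polyC_exp.
  pose d (i : 'I_n.+1) := if i == 0 then (D - m)%N else e.
  have hd : (\sum_i d i = D - m + n * e)%N.
    by rewrite big_ord_recl sum_nat_const card_ord.
  rewrite -hd; have [|sz ->] := @size_coef_det_top _ _ (W *m A) d.
    move=> i j; case: (unliftP 0 i) => [i'|] -> /=; rewrite /d /=.
      rewrite rowS; apply: leq_trans (size_sum _ _ _) _; apply/bigmax_leqP => k _.
      rewrite mul_polyC; apply: leq_trans (size_scale_leq _ _) _.
      by rewrite AE; case: (size_coef_XsubX_exp_mul (u j) e (k * p + p.-1)).
    rewrite row0; apply/leq_sizeP => l hl; rewrite coef_nderivn nth_default ?mul0rn //.
    by rewrite sz_u; have := leq_subr j n; move: hl; rewrite /D; lia.
  split=> //; rewrite (@det_row_delta _ _ _ 0 0 ('C(D, m))%:R); last first.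
    move=> j; rewrite mxE row0 /d /= coef_nderivn subnKC // -[X in X = _]mulr_natl -[RHS]mulr_natr.
    congr (_ * _); case: eqP => [->|/eqP j0].
      by have /monicP := mon_u 0; rewrite lead_coefE sz_u subn0.
    rewrite nth_default // sz_u /D.
    have : (0 < j)%N by rewrite lt0n.
    by have := ltn_ord j; rewrite ltnS; move: (val j); lia.
  rewrite addn0 mulr1 -det_mulmx exprM -detZ; congr (_ * \det _).
  apply/matrixP => i j; transitivity (((W *m A) (lift 0 i) (lift 0 j))`_e).
    by rewrite [LHS]mxE [LHS]mxE [LHS]mxE.
  rewrite rowS coef_sum big_ord_recr /= [RHS]mxE [X in _ = _ * X]mxE.
  (* The term [k = n] drops out: with column 0 removed, its index exceeds the degree of [u]. *)
  rewrite [X in _ + X](_ : _ = 0) ?addr0; last first.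
    rewrite coefCM AE (size_coef_XsubX_exp_mul _ _ _).2
      [(u _)`_ _]nth_default ?mulr0 // sz_u /bump /=.
    have -> : p = (e + m).+1 by rewrite em prednK.
    rewrite !mulSn !mulnS mulnDr; have := ltn_ord j => /=.
    by rewrite /bump; move: (nat_of_ord j) (n * e)%N (n * m)%N => x y z; lia.
  rewrite mulr_sumr; apply: eq_bigr => k _; rewrite coefCM AE (size_coef_XsubX_exp_mul _ _ _).2 mxE.
  by rewrite mulrCA mxE /u /= /bump /= add1n.
have detWA : \det W * (G ^+ (e - m) * Q) = \det (W *m A) by rewrite -detQ det_mulmx.
(* The degree bound for [W *m A] is exactly the degree of [\det W * G ^+ (e - m)], which forces the
   cofactor [Q] to be constant. *)
have degs : (D - m + n * e = p * n + n.+1 * (e - m))%N.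
  rewrite -[p in RHS](prednK p0) -em /D.
  have [k ->] : exists k, e = (m + k)%N by exists (e - m)%N; lia.
  by rewrite addKn; nia.
have W0 : \det W != 0.
  apply: contraTneq V0 => W0; move/eqP: topW.
  by rewrite W0 coef0 eq_sym mulf_eq0 signr_eq0 /= negbK.
have szW' : size (\det W) = (p * n).+1.
  apply/eqP; rewrite eqn_leq szW ltnNge; apply/negP => /leq_sizeP /(_ _ (leqnn _)) /eqP.
  by rewrite topW mulf_eq0 signr_eq0 (negbTE V0).
have szG : size (G ^+ (e - m)) = (n.+1 * (e - m)).+1 by rewrite size_linprod_exp.
have G0 : G ^+ (e - m) != 0 by rewrite monic_neq0 // monic_exp ?monic_linprod.
have [q Qq] : exists q, Q = q%:P.
  exists Q`_0; apply: size1_polyC; have [->|Q0] := eqVneq Q 0; first by rewrite size_poly0.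
  move: szB; rewrite -detWA size_mul ?mulf_neq0 // size_mul // szW' szG degs.
  by move: (size Q) => x; lia.
rewrite detQ Qq; congr (_ * _%:P).
move: topB; rewrite -detWA degs coefM_top ?szW' //; last first.
  by rewrite Qq mulrC mul_polyC (leq_trans (size_scale_leq _ _)) ?szG.
rewrite topW Qq [G ^+ _ * _]mulrC mul_polyC coefZ.
have /monicP := monic_exp (e - m) (monic_linprod (b :: s)); rewrite lead_coefE -/G szG /= => ->.
rewrite mulr1 => hq; apply: (mulfI V0).
transitivity ((-1) ^+ n * ((-1) ^+ n * \det V * q)).
  by rewrite !mulrA -expr2 sqrr_sign mul1r.
by rewrite hq; ring.
Qed.

(** * Vandermonde product, factorials modulo [p], and the induction on the roots *)

Fixpoint vdm (R : nzRingType) (s : seq R) : R :=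
  if s is a :: t then (linprod t).[a] * vdm t else 1.

Lemma vdm_enum (R : comNzRingType) (r : nat) (x : 'I_r -> R) :
  vdm [seq x i | i <- enum 'I_r] = \prod_(i < r) \prod_(j < r | (i < j)%N) (x i - x j).
Proof.
elim: r x => [|r IH] x; first by rewrite big_ord0 (size0nil (size_enum_ord 0)).
rewrite enum_ordSl /= -map_comp IH big_ord_recl; congr (_ * _).
  rewrite [RHS]big_mkcond big_ord_recl /= mul1r horner_prod big_map big_enum /=.
  by apply: eq_bigr => i _; rewrite !hornerE.
apply: eq_bigr => i _; rewrite [RHS]big_mkcond big_ord_recl /= mul1r -big_mkcond.
exact: eq_bigl.
Qed.

Lemma natr_pchar_opp (R : nzRingType) (p : nat) (pR : p \in [pchar R]) (q a b : nat) :
  (a + b = q * p)%N -> a%:R = - b%:R :> R.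
Proof. by move=> ab; apply/eqP; rewrite -addr_eq0 -natrD ab natrM (pcharf0 pR) mulr0. Qed.

(** The case [m = 0] is Wilson's theorem; each further step uses that [m.+1] is [- e.+1] modulo
    [p]. *)
Lemma fact_compl_pchar (R : comNzRingType) (p : nat) (pR : p \in [pchar R]) (e m : nat) :
  (e + m)%N = p.-1 -> (e`!)%:R * (m`!)%:R = (-1) ^+ m.+1 :> R.
Proof.
have p_pr := pcharf_prime pR; have p0 := prime_gt0 p_pr.
elim: m e => [|m IH] e em.
  rewrite addn0 in em; rewrite em mulr1.
  have := p_pr; rewrite Wilson ?prime_gt1 // => /dvdnP [q hq].
  by rewrite (natr_pchar_opp pR (b := 1) (q := q)) // addn1.
have em' : (e.+1 + m = p.-1)%N by rewrite -em; lia.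
rewrite exprS -(IH _ em') !factS !natrM (natr_pchar_opp pR (a := m.+1) (b := e.+1) (q := 1)).
  by ring.
by rewrite mul1n -(prednK p0) -em'; lia.
Qed.

(** Comparing the two extreme cases of [fact_compl_pchar] treats odd [p] and [p = 2] at once. *)
Lemma signr_pchar (R : comNzRingType) (p : nat) (pR : p \in [pchar R]) :
  (-1) ^+ p.-1 = 1 :> R.
Proof.
have p0 := prime_gt0 (pcharf_prime pR).
have := fact_compl_pchar pR (add0n p.-1); rewrite mulrC (fact_compl_pchar pR (addn0 p.-1)).
by rewrite [_ ^+ p.-1.+1]exprS expr1 mulN1r => /oppr_inj.
Qed.

(** Modulo [p] the factor [D - i] is [-(k + i + 1)], so the falling factorial of [D] continues [k!]
    upwards. *)
Lemma fact_ffact_pchar (R : comNzRingType) (p : nat) (pR : p \in [pchar R])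
    (q D k m : nat) : (D + k.+1 = q * p)%N -> (m <= D)%N ->
  (k`!)%:R * (D ^_ m)%:R = (-1) ^+ m * ((k + m)`!)%:R :> R.
Proof.
move=> Dk; elim: m => [|m IH] mD; first by rewrite addn0 ffactn0 mulr1 mul1r.
rewrite ffactnSr natrM mulrA IH; last exact: ltnW.
rewrite addnS factS natrM (natr_pchar_opp pR (a := D - m) (b := (k + m).+1) (q := q)).
  by rewrite exprS; ring.
by rewrite -Dk; lia.
Qed.

(** This evaluates the binomial of [det_cartier_var] as the ratio of successive constants, in
    product form to avoid division. *)
Lemma bin_fact_pchar (R : comNzRingType) (p : nat) (pR : p \in [pchar R])
    (q D k e m : nat) : (e + m)%N = p.-1 -> (D + k.+1 = q * p)%N -> (m <= D)%N ->
  'C(D, m)%:R * (k`!)%:R = - (((k + m)`!)%:R * (e`!)%:R) :> R.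
Proof.
move=> em Dk mD; have := fact_ffact_pchar pR Dk mD; rewrite -bin_ffact natrM => h1.
have h2 := fact_compl_pchar pR em.
transitivity ((-1) ^+ m * (-1) ^+ m * ('C(D, m)%:R * (k`!)%:R) : R).
  by rewrite -expr2 sqrr_sign mul1r.
transitivity (- (-1) ^+ m * ((e`!)%:R * (m`!)%:R) * ('C(D, m)%:R * (k`!)%:R) : R).
  by rewrite h2 exprS; ring.
transitivity (- (-1) ^+ m * (e`!)%:R * ((k`!)%:R * ('C(D, m)%:R * (m`!)%:R)) : R); first by ring.
rewrite h1.
transitivity (- ((-1) ^+ m * (-1) ^+ m * (((k + m)`!)%:R * (e`!)%:R)) : R).
  by ring.
by rewrite -expr2 sqrr_sign mul1r.
Qed.

Lemma triangular_half (k : nat) : ((k.+1 * k.+2) %/ 2 = (k * k.+1) %/ 2 + k.+1)%N.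
Proof.
by rewrite (_ : k.+1 * k.+2 = k.+1 * 2 + k * k.+1)%N ?divnMDl // 1?addnC //; nia.
Qed.

(** For [m = p.-1 - e] this is [eps0], taken in an arbitrary ring. *)
Definition cartier_const (R : nzRingType) (m e r : nat) : R :=
  (-1) ^+ ((r.+1 * r.+2) %/ 2 + (r * r.+1) %/ 2 * e)%N
  * ((r * m)`!)%:R * (e`!)%:R ^+ r.

Lemma det_cartier_linprod (R : idomainType) (p e m : nat) (a : R) (s : seq R) :
  p \in [pchar R] -> (e + m)%N = p.-1 -> (m <= e)%N -> ((size s).+1 * m <= p.-1)%N ->
  uniq (a :: s) ->
  \det (cartier_mx p (linprod (a :: s) ^+ e) (size s)) =
    cartier_const R m e (size s).+1 * vdm (a :: s) ^+ (e - m).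
Proof.
move=> pR em me; elim: s a => [|b s IH] a nm us.
  (* With a single root the determinant is empty, and Wilson's theorem shows that the constant is
     1. *)
  rewrite det_mx00 /= /linprod big_nil !hornerE /cartier_const expr1n mulr1 !mul1n expr1 -mulrA.
  rewrite [X in _ * X]mulrC (fact_compl_pchar pR em) -exprD.
  rewrite (_ : _ + _ = e + m + 4)%N ?em; last by lia.
  by rewrite exprD signr_pchar // mul1r -signr_odd.
have nm' : ((size s).+1 * m <= p.-1)%N by apply: leq_trans nm; rewrite leq_mul2r leqnSn orbT.
case/andP: (us) => _ us'; case/andP: (us') => _ us''.
have := det_cartier_var b pR em me nm us''; rewrite (IH b nm' us').
(* The indeterminate root is specialised to [a]. *)
have hmap : map_poly (horner_eval a) (linprod ('X :: map polyC (b :: s)) ^+ e) =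
    linprod [:: a, b & s] ^+ e.
  rewrite rmorphXn /= map_linprod /= -map_comp /horner_eval hornerX hornerC.
  by congr (linprod [:: _, _ & _] ^+ _); rewrite map_id_in // => c _ /=; rewrite hornerC.
set g := (e - m)%N; set V := vdm (b :: s).
rewrite -[vdm [:: a, b & s]]/((linprod (b :: s)).[a] * V).
move/(congr1 (horner_eval a)); rewrite -det_map_mx map_cartier_mx hmap => ->.
rewrite [LHS]/horner_eval hornerM horner_exp hornerC.
rewrite [(_ * V) ^+ g]exprMn [RHS]mulrCA; congr (_ * _).
rewrite mulrA; congr (_ * _).
rewrite /cartier_const /=; set n := size s.
have p0 := prime_gt0 (pcharf_prime pR).
have hD : (n + n.+1 * e + (n.+1 * m).+1 = n.+1 * p)%N.
  by rewrite -(prednK p0) -em; nia.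
have mD : (m <= n + n.+1 * e)%N by nia.
have hC := bin_fact_pchar pR em hD mD.
have -> : ((n.+2 * m) = n.+1 * m + m)%N by rewrite mulSn addnC.
rewrite (triangular_half n.+2).
set X := (n.+2 * n.+3 %/ 2)%N; set Y := (n.+1 * n.+2 %/ 2)%N.
have XY : X = (Y + n.+2)%N := triangular_half n.+1.
(* The sign exponents of the two sides are matched up to the even number [2 * (1 + e)]. *)
have -> : (X + n.+3 + X * e = X + Y * e + (n + e * n + 1) + 2 * (1 + e))%N.
  by rewrite XY; ring.
rewrite [in RHS]exprD [in RHS](exprM _ 2) sqrrN !expr1n mulr1 !exprD expr1.
transitivity ((-1) ^+ n * (-1) ^+ (e * n) * ((-1) ^+ X * (-1) ^+ (Y * e)) *
  ('C(n + n.+1 * e, m)%:R * ((n.+1 * m)`!)%:R) * e`!%:R ^+ n.+1 : R); first by ring.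
by rewrite hC [_ ^+ n.+2]exprS; ring.
Qed.

(** By the degree hypothesis the last row reads off the coefficient of index [size s * e + d], the
    degree of the polynomial in column 0; the later columns have smaller degree. *)
Lemma det_cartier_pred (R : idomainType) (p e d : nat) (s : seq R) : (0 < p)%N ->
  (size s * e + d.+1 = d.+1 * p)%N ->
  \det (cartier_mx p (linprod s ^+ e) d.+1) =
    (-1) ^+ d * \det (cartier_mx p (linprod s ^+ e) d).
Proof.
move=> p0 deg; rewrite (@det_row_delta _ _ _ ord_max 0 1) ?mul1r ?addn0.
  congr (_ * \det _); apply/matrixP => i j; rewrite !mxE lift_max.
  by rewrite subSS.
move=> j; rewrite !mxE coefXnM subSS /=.
have -> : (d * p + p.-1 = size s * e + d)%N by move: deg; rewrite mulSn -(prednK p0); lia.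
rewrite ltnNge (leq_trans (leq_subr _ _)) ?leq_addl //=.
have -> : (size s * e + d - (d - j) = size s * e + j)%N by have := ltn_ord j; lia.
case: eqP => [->|/eqP j0].
  have /monicP := monic_exp e (monic_linprod s).
  by rewrite lead_coefE size_linprod_exp addn0.
rewrite nth_default // size_linprod_exp -addn1 leq_add2l lt0n.
exact: j0.
Qed.

(** * Return to [Mmat] and to the three families of triples *)

Lemma fpoly_linprod (p r : nat) :
  fpoly p r = linprod [seq 'X_i | i <- enum 'I_r] :> {poly {mpoly 'F_p[r]}}.
Proof. by rewrite /linprod big_map big_enum. Qed.

Lemma Mmat_cartier (p r e d : nat) : (0 < p)%N ->
  Mmat p r e d = cartier_mx p (fpoly p r ^+ e) d.
Proof.
move=> p0; apply/matrixP => i j; rewrite !mxE coefXnM; have := ltn_ord j => jd.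
have ip : (i.+1 * p = i * p + p.-1 + 1)%N by rewrite mulSn; lia.
rewrite ip; case: ltnP => h.
  (* A negative index corresponds to a coefficient below the shift by the power of ['X]; both are
     zero. *)
  rewrite (_ : _ - _ = Negz (d - j.+1 - (i * p + p.-1)).-1) //.
  by rewrite NegzE; lia.
rewrite (_ : _ - _ = (i * p + p.-1 - (d - j.+1))%N%:Z) //.
by move: (i * p)%N h => x h; lia.
Qed.

Lemma det_Mmat_B0 (p r e d : nat) : prime p -> inB0 p r e d ->
  \det (Mmat p r e d) = (eps0 p r e)%:MP * delta p r ^+ (2 * e - p.-1).
Proof.
move=> hp [/andP [r2 rp] h1 h2 h3 ->].
have pF : p \in [pchar 'F_p] by exact: pchar_Fp.
have pM : p \in [pchar {mpoly 'F_p[r]}] by exact: (rmorph_pchar (@mpolyC r 'F_p) pF).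
rewrite Mmat_cartier ?prime_gt0 // fpoly_linprod /delta -vdm_enum.
set s := map _ _.
have us : uniq s.
  rewrite map_inj_uniq ?enum_uniq // => i j /(congr1 (mcoeff U_(i))).
  rewrite !mcoeffX eqxx eq_sym eq_mnm1; case: eqP => // _ /eqP.
have ss : size s = r by rewrite size_map size_enum_ord.
have es : cartier_const _ (p.-1 - e) e r = (eps0 p r e)%:MP :> {mpoly 'F_p[r]}.
  by rewrite /cartier_const /eps0 !rmorphM !rmorphXn !rmorph_nat rmorphN1.
have -> : (2 * e - p.-1 = e - (p.-1 - e))%N by lia.
case: s us ss => [|a t] us /=; first lia.
move=> st; have {}st : size t = r.-1 by exact: (congr1 predn st).
rewrite (_ : (linprod t).[a] * vdm t = vdm (a :: t)) // -es.
have := @det_cartier_linprod _ p e (p.-1 - e) a t pM; rewrite st prednK; last by lia.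
by apply=> //; lia.
Qed.

Lemma eps0_neq0 (p r e : nat) : prime p -> (e <= p.-1)%N -> (r * (p.-1 - e) <= p.-1)%N ->
  eps0 p r e != 0.
Proof.
move=> hp h1 h2.
have fact0 k : (k <= p.-1)%N -> (k`!)%:R != 0 :> 'F_p.
  move=> kp; apply/eqP => k0; have /eqP := fact_compl_pchar (pchar_Fp hp) (subnKC kp).
  by rewrite k0 mul0r eq_sym signr_eq0.
by rewrite !mulf_neq0 ?signr_eq0 ?expf_neq0 ?fact0.
Qed.

Lemma det_Mmat_pred (p r e d : nat) : (0 < p)%N -> (r * e + d.+1 = d.+1 * p)%N ->
  \det (Mmat p r e d.+1) = (-1) ^+ d * \det (Mmat p r e d).
Proof.
move=> p0 deg; rewrite !Mmat_cartier // fpoly_linprod det_cartier_pred //.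
by rewrite size_map size_enum_ord.
Qed.

Theorem theorem1 (p : nat) (hp : prime p) :
  (forall r e d : nat, inB p r e d -> inA p r e d)
  /\ (forall r e d : nat, inB0 p r e d ->
        eps0 p r e != 0 /\
        \det (Mmat p r e d) = (eps0 p r e)%:MP * delta p r ^+ (2 * e - p.-1))
  /\ (forall r e d : nat, inBplus p r e d ->
        inB0 p r e d.-1 /\
        forall eps' : 'F_p,
          \det (Mmat p r e d.-1) = eps'%:MP * delta p r ^+ (2 * e - p.-1) ->
          \det (Mmat p r e d) = ((-1) ^+ r.-1 * eps')%:MP * delta p r ^+ (2 * e - p.-1))
  /\ (forall r e d : nat, inBminus p r e d ->
        inB0 p r e d.+1 /\
        forall eps' : 'F_p,
          \det (Mmat p r e d.+1) = eps'%:MP * delta p r ^+ (2 * e - p.-1) ->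
          \det (Mmat p r e d) = ((-1) ^+ r * eps')%:MP * delta p r ^+ (2 * e - p.-1)).
Proof.
have p1 := prime_gt1 hp; have p0 := prime_gt0 hp.
have H0 r e d : inB0 p r e d -> eps0 p r e != 0 /\
    \det (Mmat p r e d) = (eps0 p r e)%:MP * delta p r ^+ (2 * e - p.-1).
  by move=> h; split; [case: h => *; exact: eps0_neq0 | exact: det_Mmat_B0].
have Hp r e d : inBplus p r e d -> inB0 p r e d.-1 /\ forall eps' : 'F_p,
    \det (Mmat p r e d.-1) = eps'%:MP * delta p r ^+ (2 * e - p.-1) ->
    \det (Mmat p r e d) = ((-1) ^+ r.-1 * eps')%:MP * delta p r ^+ (2 * e - p.-1).
  case=> /andP [r2 rp] -> ->; split; first by split; rewrite ?subnn ?muln0 //; lia.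
  case: r r2 rp => // r r2 rp eps' /= E.
  rewrite det_Mmat_pred // ?E; first by rewrite rmorphM rmorph_sign mulrA.
  by rewrite -{2}(prednK p0) mulnS addnC.
have Hm r e d : inBminus p r e d -> inB0 p r e d.+1 /\ forall eps' : 'F_p,
    \det (Mmat p r e d.+1) = eps'%:MP * delta p r ^+ (2 * e - p.-1) ->
    \det (Mmat p r e d) = ((-1) ^+ r * eps')%:MP * delta p r ^+ (2 * e - p.-1).
  case=> r2 h1 h2 h3 ->.
  (* If [e = p.-1], the equation would give [p = 1]; if [r = 2], it would give [2 * e = p.-1]. Hence
     [d >= 1], and [r <= p.-1] as [r] divides [p.-1]. *)
  have pe : (p.-1 - e != 0)%N by apply/eqP => h; move: h3; rewrite h muln0; lia.
  have r3 : (2 < r)%N.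
    by rewrite ltn_neqAle r2 andbT; apply/eqP => rE; move: h3; rewrite -rE; lia.
  split.
    split; rewrite ?h3 //; try lia.
    rewrite r2 /= (@leq_trans p.-1) ?leqnSn //; last by lia.
    by rewrite -h3 leq_pmulr // lt0n.
  case: r r2 h1 h2 h3 r3 => [|[|r]] // _ h1 h2 h3 r3 eps' /=.
  rewrite det_Mmat_pred //; last first.
    (* The equation [r * (p.-1 - e) = p.-1] is the degree condition of [det_Mmat_pred]; writing
       [p = (e + k).+1] removes the subtraction. *)
    have [k hk] : exists k, p = (e + k).+1 by exists (p.-1 - e)%N; lia.
    by move: h3; rewrite hk /= addKn; nia.
  move=> E; rewrite -[LHS]mul1r -(sqrr_sign _ r) expr2 -mulrA E.
  by rewrite mulrA rmorphM -[r.+2]addn2 exprD sqrrN expr1n mulr1 rmorph_sign.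
split; last by split.
have inA_of r e d c : (2 <= r)%N -> (1 <= d <= p)%N -> (p.-1 < 2 * e)%N -> c != 0 ->
    \det (Mmat p r e d) = c%:MP * delta p r ^+ (2 * e - p.-1) -> inA p r e d.
  move=> r2 hd h1 c0 E; split=> //; first lia.
  by exists c => //; exists (2 * e - p.-1)%N => //; lia.
move=> r e d [h|[h|h]].
- have [h0 rel] := Hp _ _ _ h; have [e0 E] := H0 _ _ _ h0.
  case: h h0 => /andP [r2 rp] _ dr [_ h1 _ _ _].
  apply: inA_of (rel _ E) => //; first lia.
  by rewrite mulf_neq0 ?signr_eq0.
- have [e0 E] := H0 _ _ _ h; case: h => /andP [r2 rp] h1 _ _ dr.
  by apply: inA_of E => //; lia.
- have [h0 rel] := Hm _ _ _ h; have [e0 E] := H0 _ _ _ h0.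
  case: h h0 => r2 h1 h2 h3 dr [/andP [_ rp] _ _ _ dr'].
  apply: inA_of (rel _ E) => //; last by rewrite mulf_neq0 ?signr_eq0.
  have r3 : (r != 2)%N by apply/eqP => rE; move: h3; rewrite rE; lia.
  by lia.
Qed.
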